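(* Let $P_0,P_1$ be probability measures on a measurable space $(\mathcal X,\mathcal B_{\mathcal X})$ with $P_1\ll P_0$ and $\mathrm{KL}(P_1\|P_0)<\infty$. Let $E:\mathcal X\to[0,\infty]$ be measurable with $\mathbb E_{P_0}[E]\le1$, let $W_t=\prod_{n\le t}E(X_n)$ ($W_0=1$) be the i.i.d. product generated by $E$, and let $\alpha\in(0,1)$, $\ell=\log\frac1\alpha$. Then for every $s\in[0,\infty)$ and $t\in\mathbb N$, $$\bar\gamma_t(\alpha)\le\gamma_t(\alpha)\le\exp\big(s\ell-t\,\Lambda_s(E)\big),$$ so that $\liminf_{t\to\infty}-\frac1t\log\gamma_t(\alpha)\ge\Lambda(E)$. If in addition $\mathbb E_{P_1}|\log E|<\infty$, $\mathbb E_{P_1}[\log E]>0$, and $0$ lies in the interior of $\{x\in\mathbb R: I(x)<\infty\}$, where $I(x)=\sup_{\theta\in\mathbb R}\{\theta x-\log\mathbb E_{P_1}[e^{\theta\log E}]\}$ is the Cramér rate function of $\log E$ under $P_1$, then $$\lim_{t\to\infty}-\frac1t\log\gamma_t(\alpha)=\Lambda(E).$$ For the sequential error, $\liminf_{t\to\infty}-\frac1t\log\bar\gamma_t(\alpha)\ge\Lambda(E)$.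
   Context: $X_1,X_2,\dots$ are the coordinates on $\Omega=\mathcal X^{\mathbb N}$, $\mathbb N=\{1,2,\dots\}$, and $\mathbb P_1=P_1^{\otimes\mathbb N}$. With $\tau_\alpha:=\inf\{t\in\mathbb N:W_t>\frac1\alpha\}$ ($\inf\emptyset=\infty$), put $\gamma_t(\alpha):=\mathbb P_1(W_t\le\frac1\alpha)$ and $\bar\gamma_t(\alpha):=\mathbb P_1(\tau_\alpha>t)$. For $s\ge0$, $\Lambda_s(E):=-\log\mathbb E_{P_1}[E^{-s}]\in[-\infty,\infty]$, and $\Lambda(E):=\sup_{s\ge0}\Lambda_s(E)\in[0,\infty]$. Conventions: natural log, $\log0=-\infty$, $\log(+\infty)=+\infty$, $e^{-\infty}=0$, $e^{+\infty}=+\infty$, $0\cdot\infty=0$; $x^0=1$ for all $x\in[0,\infty]$; for $s>0$, $0^{-s}=+\infty$ and $(+\infty)^{-s}=0$. *)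

(* Defs.v *)
From mathcomp Require Import all_boot all_order all_algebra.
From mathcomp Require Import all_classical all_reals all_analysis.
From mathcomp Require Import measurable_realfun.
Set Implicit Arguments.
Unset Strict Implicit.
Unset Printing Implicit Defensive.
Import Order.TTheory GRing.Theory Num.Theory.
Import numFieldNormedType.Exports.
Local Open Scope classical_set_scope.
Local Open Scope ring_scope.
Local Open Scope ereal_scope.
Local Open Scope charge_scope.

Section sequence_space.
Context d (T : measurableType d).

Definition coordinate_cylinders : set (set (nat -> T)) :=
  \bigcup_n preimage_set_system [set: nat -> T] (fun w => w n) measurable.

(* The sequence space T^N with its product sigma-algebra. Sequences are
   0-based: the coordinate X_n of the text (n >= 1) is [w n.-1]. *)
Definition seq_space := g_sigma_algebraType coordinate_cylinders.

(* PP is the product measure P^{\otimes N}. The cylinders below form a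
   pi-system generating the product sigma-algebra, so PP is unique; that such
   a PP exists for every P is the classical theorem on infinite products of
   probability measures. *)
Definition is_iid_product (R : realType) (P : probability T R)
    (PP : probability seq_space R) :=
  forall (n : nat) (A : nat -> set T), (forall i, measurable (A i)) ->
    PP [set w : seq_space | forall i, (i < n)%N -> A i (w i)] =
    \prod_(i < n) P (A i).

End sequence_space.

Section divergence.
Context d (T : measurableType d) (R : realType).

Definition KL (P Q : probability T R) : \bar R :=
  if `[< P `<< Q >]
  then \int[P]_x lne (('d (charge_of_finite_measure P) '/d Q) x)
  else +oo.

End divergence.

Section product_process.
Context d (T : measurableType d) (R : realType).
Implicit Types (E : T -> \bar R) (w : seq_space T).

(* [mule] satisfies 0 * +oo = 0. *)
Definition wealth E (t : nat) w : \bar R := \prod_(i < t) E (w i).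

(* [ereal_inf set0] is +oo. *)
Definition rejection_time E (alpha : R) w : \bar R :=
  ereal_inf [set t%:R%:E | t in
    [set t : nat | (0 < t)%N /\ (alpha^-1)%:E < wealth E t w]].

Definition gamma (PP : probability (seq_space T) R) E (alpha : R) (t : nat) :=
  PP [set w | wealth E t w <= (alpha^-1)%:E].

Definition gamma_seq (PP : probability (seq_space T) R) E (alpha : R)
    (t : nat) :=
  PP [set w | t%:R%:E < rejection_time E alpha w].

(* At t = 0 the value is irrelevant to the limits at infinity. *)
Definition decay_rate (u : nat -> \bar R) (t : nat) : \bar R :=
  - ((t%:R^-1)%:E * lne (u t)).

End product_process.

Section exponents.
Context d (T : measurableType d) (R : realType).
Variable P : probability T R.

(* For s >= 0 and x in [0, +oo], [(x `^ s)^-1] is x^{-s}: it equals 1 for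
   s = 0, and for s > 0 it sends 0 to +oo and +oo to 0. Writing [x `^ (- s)]
   instead would send 0 to 0. *)
Definition Lambda_at (E : T -> \bar R) (s : R) : \bar R :=
  - lne (\int[P]_x (E x `^ s)^-1).

Definition Lambda (E : T -> \bar R) : \bar R :=
  ereal_sup [set Lambda_at E s | s in [set s : R | (0 <= s)%R]].

Definition cramer_rate (Y : T -> \bar R) (x : R) : \bar R :=
  ereal_sup [set (theta * x)%:E - lne (\int[P]_y expeR (theta%:E * Y y))
            | theta in [set: R]].

End exponents.

(* Main.v *)
(* Upper bound on [gamma]: Markov's inequality for [W_t^(-s)], whose mean
   factorizes over the coordinates.

   Lower bound: as [1 / alpha > 1], [gamma] is at least the probability of
   [W_t <= 1]. Restrict to coordinates with [y := log E] in [[-N, N]] and let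
   [M s] be the truncated moment [E[exp (- s y)]]. Splitting [exp (- s S_t)]
   according to whether [- c t <= S_t <= 0] gives
     [M s ^ t <= exp (s c t) P(S_t <= 0) + M (s - v) ^ t
                 + (exp (- v c) M (s + v)) ^ t],
   so that the decay rate is at most [s c - ln (M s)] as soon as
   [M (s - v) < M s] and [exp (- v c) M (s + v) < M s]. On a grid of mesh
   [v = N^-3] the first increase of [M] provides such an [s], with [s c]
   of order [1 / N]: this replaces the exponentially tilted measure and the law
   of large numbers of the usual proof of Cramer's theorem. The finiteness of
   the Cramer rate function at some negative point yields [P1(E < 1) > 0], which
   keeps [s] bounded as [N] grows; along a convergent subsequence Fatou's lemma
   gives an exponent [s] with [Lambda_s] at least the limsup of the rates. *)
Require Import Defs.
From mathcomp Require Import all_boot all_order all_algebra.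
From mathcomp Require Import all_classical all_reals all_analysis.
From mathcomp Require Import measurable_realfun.
From mathcomp Require Import ring lra.
Set Implicit Arguments.
Unset Strict Implicit.
Unset Printing Implicit Defensive.
Import Order.TTheory GRing.Theory Num.Theory.
Import numFieldNormedType.Exports.
Local Open Scope classical_set_scope.
Local Open Scope ring_scope.
Local Open Scope ereal_scope.

Import HBNNSimple.

(** * Integrals of products over independent coordinates *)

(** Multiplication by [+oo] is discontinuous at 0. Monotonicity repairs this: a nonnegative
    nondecreasing sequence with limit 0 vanishes identically. *)
Lemma cvgeZl_nondecreasing (R : realType) (c l : \bar R) (a : nat -> \bar R) :
  0 <= c -> (forall n, 0 <= a n) -> nondecreasing_seq a ->
  a n @[n --> \oo] --> l -> c * a n @[n --> \oo] --> c * l.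
Proof.
move=> c0 a0 nda al.
have al_le n : a n <= l.
  by apply: (cvge_ge _ al); near=> m; apply: nda; near: m; exists n.
have [cfin|] := boolP (c \is a fin_num); first exact: cvgeZl.
rewrite ge0_fin_numE// -leNgt leye_eq => /eqP ->.
have [l0|l_neq0] := eqVneq l 0.
  have an0 n : a n = 0 by apply/eqP; rewrite eq_le a0 -l0 al_le.
  by under eq_fun do rewrite an0 mule0; rewrite l0 mule0; exact: cvg_cst.
apply: cvgeM; [by rewrite mule_def_infty_neq0|exact: cvg_cst|exact: al].
Unshelve. all: by end_near. Qed.

(** Indicators extend to simple functions by linearity, then to nonnegative functions by monotone
    convergence. In [integral_prod_iid] the weight [g] is the product of the other coordinates; [c],
    the product of their integrals, may be infinite. *)
Lemma integral_mul_comp d1 d2 (U : measurableType d1) (T : measurableType d2)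
    (R : realType) (mu : {measure set U -> \bar R})
    (nu : {measure set T -> \bar R}) (g : U -> \bar R) (X : U -> T)
    (c : \bar R) (f : T -> \bar R) :
  measurable_fun setT g -> (forall u, 0 <= g u) -> measurable_fun setT X ->
  0 <= c ->
  (forall A, measurable A ->
    \int[mu]_u (g u * (\1_A (X u))%:E) = c * nu A) ->
  measurable_fun setT f -> (forall x, 0 <= f x) ->
  \int[mu]_u (g u * f (X u)) = c * \int[nu]_x f x.
Proof.
move=> mg g0 mX c0 hind mf f0.
pose h := nnsfun_approx measurableT mf.
have h_ge0 n x : (0 <= h n x)%R by [].
have nd_h x : {homo (fun n => (h n x)%:E) : m n / (m <= n)%N >-> m <= n}.
  by move=> m n mn; rewrite lee_fin; exact/lefP/nd_nnsfun_approx.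
have cvg_h x : (h n x)%:E @[n --> \oo] --> f x.
  exact: (cvg_nnsfun_approx measurableT mf (fun x _ => f0 x)).
have mgh n : measurable_fun setT (fun u => g u * (h n (X u))%:E).
  apply: emeasurable_funM => //; apply/measurable_EFinP.
  exact: measurableT_comp.
have gh0 n u : 0 <= g u * (h n (X u))%:E by rewrite mule_ge0 ?lee_fin.
have simple n : \int[mu]_u (g u * (h n (X u))%:E) = c * \int[nu]_x (h n x)%:E.
  have mr r : measurable (h n @^-1` [set r]) by [].
  under eq_integral => u _.
    rewrite fimfunE -fsumEFin// ge0_mule_fsumr; last first.
      by move=> r; exact: nnfun_muleindic_ge0.
    over.
  rewrite ge0_integral_fsum//; first last.
  - by move=> r u _; rewrite mule_ge0//; exact: nnfun_muleindic_ge0.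
  - move=> r; apply: emeasurable_funM => //; apply/measurable_EFinP.
    apply: measurable_funM => //; apply: measurableT_comp => //.
  rewrite integralT_nnsfun sintegralE ge0_mule_fsumr//; last first.
    by move=> r; exact: nnsfun_mulemu_ge0.
  apply: eq_fsbigr => r /set_mem[x _ hx].
  have r0 : (0 <= r)%R by rewrite -hx.
  under eq_integral do rewrite EFinM muleCA.
  rewrite ge0_integralZl//; first by rewrite hind// muleCA.
  - apply: emeasurable_funM => //; apply/measurable_EFinP.
    exact: measurableT_comp.
  - by move=> u _; rewrite mule_ge0// lee_fin.
have cvg_gh u : g u * (h n (X u))%:E @[n --> \oo] --> g u * f (X u).
  apply: cvgeZl_nondecreasing (cvg_h (X u)) => // n.
  by rewrite lee_fin.
have lim_g : \int[mu]_u (g u * (h n (X u))%:E) @[n --> \oo] -->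
    \int[mu]_u (g u * f (X u)).
  rewrite [X in _ --> X](_ : _ =
      \int[mu]_u limn (fun n => g u * (h n (X u))%:E)); last first.
    by apply: eq_integral => u _; apply/esym/cvg_lim.
  apply: cvg_monotone_convergence => // u _ m n mn.
  by apply: lee_pmul => //; [rewrite lee_fin|exact: nd_h].
have lim_f : \int[nu]_x (h n x)%:E @[n --> \oo] --> \int[nu]_x f x.
  rewrite [X in _ --> X](_ : _ = \int[nu]_x limn (fun n => (h n x)%:E));
    last by apply: eq_integral => x _; apply/esym/cvg_lim.
  apply: cvg_monotone_convergence => // n; first exact/measurable_EFinP.
  by move=> x _; rewrite lee_fin.
rewrite -(cvg_lim _ lim_g)//; apply: cvg_lim => //.
under eq_fun do rewrite simple.
apply: cvgeZl_nondecreasing => // [n|m n mn].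
  by apply: integral_ge0 => x _; rewrite lee_fin.
apply: ge0_le_integral => // [x _|||x _].
- by rewrite lee_fin.
- exact/measurable_EFinP.
- exact/measurable_EFinP.
- exact: nd_h.
Qed.

Lemma measurable_coordinate d (T : measurableType d) (i : nat) :
  measurable_fun setT (fun w : seq_space T => w i).
Proof.
move=> _ A mA; rewrite setTI; apply: sub_sigma_algebra.
by exists i => //; exists A; rewrite ?setTI.
Qed.

Lemma measurable_cylinder d (T : measurableType d) (A : nat -> set T)
    (t : nat) :
  (forall i, measurable (A i)) ->
  measurable [set w : seq_space T | forall i, (i < t)%N -> A i (w i)].
Proof.
move=> mA; have -> : [set w : seq_space T | forall i, (i < t)%N -> A i (w i)] =
    \bigcap_(i in `I_t) (fun w : seq_space T => w i) @^-1` A i by [].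
apply: bigcap_measurableType => i _; rewrite -[_ @^-1` _]setTI.
exact: measurable_coordinate.
Qed.

Lemma measurable_prod_coordinates d (T : measurableType d) (R : realType)
    (f : nat -> T -> \bar R) (t : nat) (Q : pred nat) :
  (forall i, measurable_fun setT (f i)) ->
  measurable_fun setT (fun w : seq_space T => \prod_(i < t | Q i) f i (w i)).
Proof.
move=> mf; elim: t => [|t ih].
  have -> : (fun w : seq_space T => \prod_(i < 0 | Q i) f i (w i)) = cst 1.
    by apply/funext => w; rewrite big_ord0.
  exact: measurable_cst.
have -> : (fun w : seq_space T => \prod_(i < t.+1 | Q i) f i (w i)) =
    fun w => (\prod_(i < t | Q i) f i (w i)) * (if Q t then f t (w t) else 1).
  apply/funext => w; rewrite big_mkcond big_ord_recr/=; congr (_ * _).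
  by rewrite [RHS]big_mkcond.
apply: emeasurable_funM => //; case: (Q t) => /=.
  exact: (measurableT_comp (mf t) (measurable_coordinate t)).
exact: measurable_cst.
Qed.

Lemma integral_prod_iid d (T : measurableType d) (R : realType)
    (P : probability T R) (PP : probability (seq_space T) R)
    (f : nat -> T -> \bar R) (t : nat) :
  is_iid_product P PP -> (forall i, measurable_fun setT (f i)) ->
  (forall i x, 0 <= f i x) ->
  \int[PP]_w \prod_(i < t) f i (w i) = \prod_(i < t) \int[P]_x f i x.
Proof.
move=> iid mf f0.
(* Indicators are replaced by general functions one coordinate at a time. *)
suff hyp j : (forall i, (j <= i < t)%N -> exists2 A, measurable A &
      f i = fun x => (\1_A x)%:E) ->
    \int[PP]_w \prod_(i < t) f i (w i) = \prod_(i < t) \int[P]_x f i x.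
  by apply: (hyp t) => i /andP[/leq_ltn_trans/[apply]]; rewrite ltnn.
elim: j f mf f0 => [|j ih] f mf f0 find.
  (* All factors are indicators here: their product is the indicator of a cylinder, whose mass
     [is_iid_product] prescribes. *)
  have /choice[A hA] : forall i, exists A, measurable A /\
      ((i < t)%N -> f i = fun x => (\1_A x)%:E).
    move=> i; have [it|it] := ltnP i t; last by exists setT.
    by have [A mA fA] := find i it; exists A.
  have mA i : measurable (A i) by have [] := hA i.
  rewrite (eq_integral (fun w : seq_space T =>
      (\1_[set w : seq_space T | forall i, (i < t)%N -> A i (w i)] w)%:E)).
    rewrite integral_indic//; last exact: measurable_cylinder.
    rewrite setIT; transitivity (\prod_(i < t) P (A i)); first exact: iid.
    apply: eq_bigr => i _; rewrite (hA i).2//.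
    by rewrite integral_indic// setIT.
  move=> w _; under eq_bigr => i _ do rewrite (hA i).2//.
  rewrite indicE; have [/set_mem wA|/negP wA] := boolP (w \in _).
    by rewrite big1// => i _; rewrite indicE mem_set//; exact: wA.
  have [i it wAi] : exists2 i, (i < t)%N & ~ A i (w i).
    apply: contrapT => /forall2NP H; apply: wA; apply/mem_set => i it.
    by have [|/contrapT] := H i.
  rewrite (bigD1 (Ordinal it))//= indicE memNset// mul0e//.
have [jt|tj] := ltnP j t; last first.
  apply: ih => // i /andP[ji /leq_trans/(_ tj)].
  by rewrite ltnNge ji.
rewrite (bigD1 (Ordinal jt))//= muleC.
rewrite (eq_integral (fun w : seq_space T =>
    (\prod_(i < t | i != j :> nat) f i (w i)) * f j (w j))); last first.
  by move=> w _; rewrite (bigD1 (Ordinal jt))//= muleC.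
apply: (@integral_mul_comp _ _ _ _ _ PP P _ (fun w : seq_space T => w j)) => //.
- exact: (measurable_prod_coordinates t (fun i => i != j)).
- by move=> w; rewrite prode_ge0.
- exact: measurable_coordinate.
- by rewrite prode_ge0// => i _; rewrite integral_ge0.
(* With an indicator as factor [j] the induction hypothesis applies and yields the identity on sets
   that [integral_mul_comp] asks for. *)
move=> A mA; pose g : nat -> T -> \bar R :=
  fun i => if i == j then (fun x => (\1_A x)%:E) else f i.
have gj x : g j x = (\1_A x)%:E by rewrite /g eqxx.
have int_gj : \int[P]_x g j x = P A.
  by under eq_integral do rewrite gj; rewrite integral_indic// setIT.
have gi i : i != j -> g i = f i by rewrite /g => /negPf->.
have mg i : measurable_fun setT (g i).
  rewrite /g; case: ifP => // _; apply/measurable_EFinP.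
  exact: measurable_indic.
have g0 i x : 0 <= g i x by rewrite /g; case: ifP => // _; rewrite lee_fin.
rewrite (eq_integral (fun w : seq_space T => \prod_(i < t) g i (w i))).
  rewrite ih// => [|i /andP[ji it]]; last first.
    have [->|ij] := eqVneq i j; first by exists A => //; exact/funext.
    by rewrite gi//; apply: find; rewrite it ltn_neqAle eq_sym ij ji.
  rewrite (bigD1 (Ordinal jt))//= int_gj muleC.
  by congr (_ * _); apply: eq_bigr => i ij; rewrite gi.
move=> w _; rewrite [RHS](bigD1 (Ordinal jt))//= gj muleC.
by congr (_ * _); apply: eq_bigr => i ij; rewrite gi.
Qed.

(** * Inverses, powers and products in the extended reals *)

Lemma measurable_fun_inve d (T : measurableType d) (R : realType)
    (f : T -> \bar R) :
  measurable_fun setT f -> (forall x, 0 <= f x) ->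
  measurable_fun setT (fun x => (f x)^-1).
Proof.
move=> mf f0; have -> : (fun x => (f x)^-1) = fun x =>
    if f x == +oo then 0 else if f x == 0 then +oo
    else ((fine (f x)) `^ (-1))%:E.
  apply/funext => x; have := f0 x; case: (f x) => [r| |]//= r0.
  by rewrite inver eqe powR_inv1.
apply: measurable_fun_ifT; [exact: measurable_fun_eqe|exact: measurable_cst|].
apply: measurable_fun_ifT; [exact: measurable_fun_eqe|exact: measurable_cst|].
apply/measurable_EFinP.
apply: (@measurableT_comp _ _ _ _ _ _ (@powR R ^~ (-1)%R)) => //.
exact: measurableT_comp.
Qed.

(** Finiteness excludes the factors 0 and [+oo] together: since [0 * +oo = 0], they would give 0 on
    the left and [+oo] on the right. *)
Lemma prod_inve (R : realType) (I : Type) (r : seq I) (a : I -> \bar R) :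
  (forall i, 0 <= a i) -> (forall i, a i \is a fin_num) ->
  \prod_(i <- r) (a i)^-1 = (\prod_(i <- r) a i)^-1.
Proof.
move=> a0 afin.
suff [_ _ ->] : [/\ 0 <= \prod_(i <- r) a i, \prod_(i <- r) a i \is a fin_num &
    \prod_(i <- r) (a i)^-1 = (\prod_(i <- r) a i)^-1] by [].
elim: r => [|i r [ih0 ihfin ih]]; first by rewrite !big_nil inve1.
rewrite !big_cons mule_ge0// fin_numM// ih; split => //.
rewrite inveM//; move: (a0 i) (afin i) ih0 ihfin.
case: (a i) (\prod_(j <- r) a j) => [x| |] [y| |]//.
by rewrite !lee_fin/= => -> _ -> _; rewrite !implybT.
Qed.

Lemma prode_poweR (R : realType) (I : Type) (r : seq I) (a : I -> \bar R)
    (s : R) :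
  (forall i, 0 <= a i) ->
  \prod_(i <- r) (a i `^ s) = (\prod_(i <- r) a i) `^ s.
Proof.
move=> a0; suff [_ ->] : 0 <= \prod_(i <- r) a i /\
  \prod_(i <- r) (a i `^ s) = (\prod_(i <- r) a i) `^ s by [].
elim: r => [|i r [ih0 ih]]; first by rewrite !big_nil poweR1r.
by rewrite !big_cons mule_ge0// ih poweRM.
Qed.

Lemma prode_const_ord (R : realType) (x : \bar R) (t : nat) :
  \prod_(i < t) x = x ^+ t.
Proof.
by elim: t => [|t ih]; rewrite ?big_ord0// big_ord_recl ih expeS.
Qed.

Lemma prode_eq_pinfty (R : realType) (I : finType) (a : I -> \bar R) (i : I) :
  (forall j, 0 < a j) -> a i = +oo -> \prod_j a j = +oo.
Proof.
move=> a0 ai; rewrite (bigD1 i)//= ai gt0_mulye//.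
by apply: (big_ind (fun x => 0 < x)) => // x y; exact: mule_gt0.
Qed.

(** * Measurable events and null sets *)

Lemma measurable_eq_cst d (T : measurableType d) (R : realType)
    (f : T -> \bar R) (c : \bar R) :
  measurable_fun setT f -> measurable [set x | f x == c].
Proof.
move=> mf; rewrite -[X in measurable X]setTI.
rewrite (_ : [set x | _] = f @^-1` [set c]).
  exact: mf.
by apply/seteqP; split => x /= /eqP.
Qed.

Lemma measurable_wealth_le d (T : measurableType d) (R : realType)
    (E : T -> \bar R) (t : nat) (c : \bar R) :
  measurable_fun setT E ->
  measurable [set w : seq_space T | wealth E t w <= c].
Proof.
move=> mE; rewrite -[X in measurable X]setTI.
apply: emeasurable_fun_infty_c => //.
exact: (measurable_prod_coordinates t xpredT (fun=> mE)).
Qed.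

(** Integrability makes [E] finite [P0]-almost everywhere, and absolute continuity carries the null
    set over to [P1]. *)
Lemma ae_lty_dominated d (T : measurableType d) (R : realType)
    (P0 P1 : probability T R) (E : T -> \bar R) :
  P1 `<< P0 -> measurable_fun setT E -> (forall x, 0 <= E x) ->
  \int[P0]_x E x < +oo -> P1 [set x | E x == +oo] = 0.
Proof.
move=> /null_content_dominatesP dom mE E0 intE.
have mN : measurable [set x | E x == +oo] by exact: measurable_eq_cst.
apply: dom => //; apply/negligibleP => //.
have : P0.-integrable setT E.
  by apply/integrableP; split => //; under eq_integral do rewrite gee0_abs//.
move=> /integrable_ae[//|A [mA A0 sA]]; exists A; split => // x /= /eqP Ex.
by apply: sA => /= /(_ I); rewrite Ex.
Qed.

Lemma integral_modify_null d (T : measurableType d) (R : realType)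
    (mu : {measure set T -> \bar R}) (N : set T) (f g : T -> \bar R) :
  measurable N -> mu N = 0 -> measurable_fun setT f -> measurable_fun setT g ->
  (forall x, 0 <= f x) -> (forall x, 0 <= g x) ->
  (forall x, ~ N x -> f x = g x) -> \int[mu]_x f x = \int[mu]_x g x.
Proof.
move=> mN N0 mf mg f0 g0 fg; apply: ge0_ae_eq_integral => //.
exists N; split => // x /= /not_implyP[_ fgx]; apply: contrapT => Nx.
by apply: fgx; exact: fg.
Qed.

(** * The Chernoff bound for the fixed-time and the sequential error *)

Lemma measurable_neg_poweR d (T : measurableType d) (R : realType)
    (E : T -> \bar R) (s : R) :
  measurable_fun setT E -> measurable_fun setT (fun x => (E x `^ s)^-1).
Proof.
move=> mE; apply: measurable_fun_inve => [|x]; last exact: poweR_ge0.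
exact: measurableT_comp (measurable_poweR s) mE.
Qed.

Lemma chernoff_wealth d (T : measurableType d) (R : realType)
    (P : probability T R) (PP : probability (seq_space T) R)
    (E : T -> \bar R) (alpha s : R) (t : nat) :
  is_iid_product P PP -> measurable_fun setT E -> (forall x, 0 <= E x) ->
  P [set x | E x == +oo] = 0 -> (0 < alpha)%R -> (0 <= s)%R ->
  ((alpha `^ s)%R)%:E * gamma PP E alpha t <= (\int[P]_x (E x `^ s)^-1) ^+ t.
Proof.
move=> iid mE E0 Ey a0 s0.
(* On the null set [E = +oo] the integrand is made infinite, so that the
   bound below also holds for the products [0 * +oo = 0]. *)
pose h x := if E x == +oo then +oo else (E x `^ s)^-1.
have mh : measurable_fun setT h.
  apply: measurable_fun_ifT; [exact: measurable_fun_eqe|exact: measurable_cst|].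
  exact: measurable_neg_poweR.
have h_gt0 x : 0 < h x.
  rewrite /h; case: ifPn => // Ex; rewrite lt_neqAle eq_sym.
  rewrite inve_ge0 poweR_ge0 andbT inve_eq0.
  by apply: contra Ex => /eqP/poweR_eqy/eqP.
have h0 x : 0 <= h x by rewrite ltW.
have mN : measurable [set x | E x == +oo] by exact: measurable_eq_cst.
have -> : \int[P]_x (E x `^ s)^-1 = \int[P]_x h x.
  apply: (integral_modify_null mN Ey) => //.
  - exact: measurable_neg_poweR.
  - by move=> x; rewrite inve_ge0 poweR_ge0.
  - by move=> x /negP; rewrite /h => /negPf->.
rewrite -prode_const_ord -(integral_prod_iid (f := fun=> h) t iid)//.
have mA := measurable_wealth_le t (alpha^-1)%:E mE.
rewrite /gamma -[X in PP X]setIT -integral_indic//.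
rewrite -ge0_integralZl_EFin//; last 2 first.
- by apply/measurable_EFinP; exact: measurable_indic.
- exact: powR_ge0.
apply: ge0_le_integral => //.
- by move=> w _; rewrite mule_ge0// lee_fin// powR_ge0.
- apply: emeasurable_funM => //; apply/measurable_EFinP.
  exact: measurable_indic.
- exact: (measurable_prod_coordinates t xpredT (fun=> mh)).
move=> w _; rewrite indicE.
have [/set_mem/= Ww|_] := boolP (w \in _); last first.
  by rewrite mule0 prode_ge0.
rewrite mule1.
(* One infinite value of [E] makes the product of the positive factors [h] infinite; otherwise that
   product is [W_t^(-s)]. *)
have [[i Ei]|/forallNP Efin] := pselect (exists i : 'I_t, E (w i) == +oo).
  by rewrite (prode_eq_pinfty (i := i)) ?leey// /h Ei.
have hE (i : 'I_t) : h (w i) = (E (w i) `^ s)^-1.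
  by rewrite /h; case: ifP => // Ei; case: (Efin i).
under eq_bigr do rewrite hE.
rewrite prod_inve => [|i|i]; last 2 first.
- exact: poweR_ge0.
- rewrite fin_num_poweR// ge0_fin_numE// ltey; apply/negP => Ei.
  exact: (Efin i).
rewrite prode_poweR => [|i]; last exact: E0.
have W0 : 0 <= wealth E t w by rewrite prode_ge0.
(* After inversion the claim is [W_t^s <= (1 / alpha)^s], which is monotonicity of the power. *)
rewrite -/(wealth E t w) -inve_pge ?inE ?poweR_ge0 ?lee_fin ?powR_ge0//.
rewrite inver gt_eqF ?powR_gt0// -powRN -mulN1r powRrM powR_inv1 ?(ltW a0)//.
rewrite -poweR_EFin.
apply: (gt0_ler_poweR s0) => //; rewrite in_itv/= leey andbT//.
by rewrite lee_fin invr_ge0 ltW.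
Qed.

Lemma lt_rejection_time d (T : measurableType d) (R : realType)
    (E : T -> \bar R) (alpha : R) (w : seq_space T) (t : nat) :
  t%:R%:E < rejection_time E alpha w <->
  forall n, (0 < n <= t)%N -> wealth E n w <= (alpha^-1)%:E.
Proof.
split=> [tlt n /andP[n0 nt]|H].
  rewrite leNgt; apply: contraTN tlt => Wn; rewrite -leNgt.
  apply: (@le_trans _ _ n%:R%:E); last by rewrite lee_fin ler_nat.
  by apply: ereal_inf_lbound; exists n.
(* A strict lower bound does not pass to an infimum, so integrality is used: all rejection times
   beyond [t] are at least [t.+1]. *)
apply: (@lt_le_trans _ _ t.+1%:R%:E); first by rewrite lte_fin ltr_nat.
apply: le_ereal_inf_tmp => _ [n [n0 Wn] <-]; rewrite lee_fin ler_nat ltnNge.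
by apply/negP => nt; move: Wn; rewrite ltNge H// n0.
Qed.

Lemma gamma_seq_le_gamma d (T : measurableType d) (R : realType)
    (PP : probability (seq_space T) R) (E : T -> \bar R) (alpha : R) (t : nat) :
  measurable_fun setT E -> (0 < t)%N ->
  gamma_seq PP E alpha t <= gamma PP E alpha t.
Proof.
move=> mE t0; apply: le_measure; rewrite ?inE.
- rewrite [X in measurable X](_ : _ = \bigcap_(n in [set n | (0 < n <= t)%N])
    [set w : seq_space T | wealth E n w <= (alpha^-1)%:E]).
    by apply: bigcap_measurableType => n _; exact: measurable_wealth_le.
  by apply/seteqP; split => w /= /lt_rejection_time.
- exact: measurable_wealth_le.
- by move=> w /= /lt_rejection_time; apply; rewrite t0 leqnn.
Qed.

Lemma gamma_le_exp d (T : measurableType d) (R : realType)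
    (P : probability T R) (PP : probability (seq_space T) R)
    (E : T -> \bar R) (alpha s : R) (t : nat) :
  is_iid_product P PP -> measurable_fun setT E -> (forall x, 0 <= E x) ->
  P [set x | E x == +oo] = 0 -> (0 < alpha)%R -> (0 <= s)%R -> (0 < t)%N ->
  gamma PP E alpha t <=
  expeR ((s * ln alpha^-1)%:E - t%:R%:E * Lambda_at P E s).
Proof.
move=> iid mE E0 Ey a0 s0 t0; have := chernoff_wealth t iid mE E0 Ey a0 s0.
rewrite /Lambda_at; set M := \int[P]_x _ => chern.
have M0 : 0 <= M by apply: integral_ge0 => x _; rewrite inve_ge0 poweR_ge0.
have -> : expeR ((s * ln alpha^-1)%:E - t%:R%:E * - lne M) =
    ((alpha `^ (- s))%R)%:E * M ^+ t.
  rewrite muleN oppeK expeRD; congr (_ * _).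
    by rewrite /= /powR gt_eqF// lnV// mulrN mulNr.
  (* If [M = 0] then [lne M = -oo], and as [0 < t] both the exponential and [M ^+ t] are 0. *)
  have [M_eq0|M_neq0] := eqVneq M 0.
    rewrite M_eq0 le0_lneNy// gt0_muleNy ?lte_fin ?ltr0n//.
    by case: t t0 {chern} => // t _; rewrite expeS mul0e.
  have Mgt0 : 0 < M by rewrite lt_neqAle eq_sym M_neq0.
  have <- : lne (M ^+ t) = t%:R%:E * lne M by rewrite lneXn// mule_natl.
  by rewrite lneK// in_itv/= leey andbT expe_ge0.
by rewrite powRN lee_pdivlMl ?powR_gt0.
Qed.

(** * From exponential bounds to a lower bound on the rate *)

Lemma limn_einf_ge (R : realType) (u : (\bar R)^nat) (v : R^nat) (l : R) :
  v n @[n --> \oo] --> l -> (\forall n \near \oo, (v n)%:E <= u n) ->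
  l%:E <= limn_einf u.
Proof.
move=> vl vu.
have vlE : (v n)%:E @[n --> \oo] --> l%:E.
  by apply: cvg_EFin => //; exact: nearW.
rewrite -[l%:E](cvg_limn_einf_sup vlE).1 !limn_einf_lim.
apply: lee_lim; [exact: is_cvg_einfs|exact: is_cvg_einfs|].
have [N _ hN] := vu; exists N => // n /= Nn.
apply: le_ereal_inf_tmp => _ [m /= nm <-].
apply: (@le_trans _ _ (v m)%:E); last by apply: hN => /=; exact: leq_trans nm.
by apply: ereal_inf_lbound; exists m.
Qed.

Lemma decay_rate_le (R : realType) (u v : nat -> \bar R) (t : nat) :
  (0 <= u t <= v t) -> decay_rate v t <= decay_rate u t.
Proof.
move=> /andP[u0 uv]; rewrite /decay_rate leeN2 lee_wpmul2l ?lee_fin ?invr_ge0//.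
by rewrite lee_lne ?in_itv/= ?leey ?andbT// (le_trans u0).
Qed.

Lemma cvg_invn (R : realType) : (n%:R^-1 : R)%R @[n --> \oo] --> (0 : R)%R.
Proof.
apply/(gtr0_cvgV0 (f := fun n => n%:R : R)%R); last exact: cvgr_idn.
by exists 1%N => // n /= n0; rewrite ltr0n.
Qed.

(** For fixed [s] the rate at time [t] is at least [Lambda_at P E s] minus a term of order [1 / t];
    the supremum over [s] comes last. The sequence [u] is abstract so as to cover both error
    probabilities. *)
Lemma Lambda_le_limn_einf d (T : measurableType d) (R : realType)
    (P : probability T R) (E : T -> \bar R) (alpha : R) (u : nat -> \bar R) :
  (forall t, 0 <= u t) ->
  (forall s t, (0 <= s)%R -> (0 < t)%N ->
    u t <= expeR ((s * ln alpha^-1)%:E - t%:R%:E * Lambda_at P E s)) ->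
  Lambda P E <= limn_einf (decay_rate u).
Proof.
move=> u0 hu; apply: ge_ereal_sup => _ [s s0 <-].
pose g t := expeR ((s * ln alpha^-1)%:E - t%:R%:E * Lambda_at P E s).
have hdecay t : (0 < t)%N ->
    (- (s * ln alpha^-1 / t%:R))%:E + Lambda_at P E s <= decay_rate u t.
  move=> t0; apply: le_trans (decay_rate_le (v := g) _); last first.
    by rewrite u0 hu.
  rewrite /decay_rate expeRK muleBr ?fin_num_adde_defr//.
  rewrite oppeB ?fin_num_adde_defr//.
  have tVt : (t%:R^-1)%:E * (t%:R)%:E = 1 :> \bar R.
    by rewrite -EFinM mulVf// pnatr_eq0 -lt0n.
  by rewrite (muleA _ t%:R%:E) tVt mul1e mulrC.
(* An infinite exponent is treated apart: [+oo] forces the rate to be [+oo] at every [t > 0], and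
   [-oo] is a trivial bound. *)
case L : (Lambda_at P E s) hdecay => [l| |] hdecay; last by rewrite leNye.
  apply: (@limn_einf_ge _ _ (fun t => l - s * ln alpha^-1 * t%:R^-1)%R).
    rewrite -[X in _ --> X]subr0; apply: cvgB; first exact: cvg_cst.
    rewrite -[X in _ --> X](mulr0 (s * ln alpha^-1)%R); apply: cvgZl_tmp.
    exact: cvg_invn.
  exists 1%N => // t /= t0; rewrite addrC EFinD; exact: hdecay.
suff /cvg_limn_einf_sup[-> _] : decay_rate u t @[t --> \oo] --> +oo by [].
apply: cvg_near_cst; exists 1%N => // t /= t0.
by have := hdecay t t0; rewrite addey// leye_eq => /eqP.
Qed.

(** * Truncated exponential moments *)

(** Unnormalised density of the exponentially tilted law; the sign is such that [s > 0] favours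
    negative values of [y]. *)
Definition tilt (T : Type) (R : realType) (A : set T) (y : T -> R) (s : R)
    (x : T) : R :=
  (\1_A x * expR (- (s * y x)))%R.

(** The moment generating function, at [- s], of [y] restricted to [A]. It is finite for every real
    [s] once [y] is bounded on [A]. *)
Definition tilt_mass d (T : measurableType d) (R : realType)
    (P : probability T R) (A : set T) (y : T -> R) (s : R) : R :=
  (\int[P]_x tilt A y s x)%R.

Definition bounded_on d (T : measurableType d) (R : realType) (A : set T)
    (y : T -> R) (N : R) : Prop :=
  [/\ measurable A, measurable_fun setT y & forall x, A x -> (`|y x| <= N)%R].

Lemma tilt_ge0 (T : Type) (R : realType) (A : set T) (y : T -> R) (s : R)
    (x : T) : (0 <= tilt A y s x)%R.
Proof. by rewrite mulr_ge0 ?expR_ge0. Qed.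

Lemma tilt_out (T : Type) (R : realType) (A : set T) (y : T -> R) (s : R)
    (x : T) : ~ A x -> tilt A y s x = 0%R.
Proof. by move=> Ax; rewrite /tilt indicE memNset// mul0r. Qed.

Lemma tilt_in (T : Type) (R : realType) (A : set T) (y : T -> R) (s : R)
    (x : T) : A x -> tilt A y s x = expR (- (s * y x)).
Proof. by move=> Ax; rewrite /tilt indicE mem_set// mul1r. Qed.

Lemma measurable_tilt d (T : measurableType d) (R : realType) (A : set T)
    (y : T -> R) (s : R) :
  measurable A -> measurable_fun setT y -> measurable_fun setT (tilt A y s).
Proof.
move=> mA my; apply: measurable_funM; first exact: measurable_indic.
apply: measurableT_comp => //; apply: measurableT_comp => //.
exact: measurable_funM.
Qed.

Lemma integrable_tilt d (T : measurableType d) (R : realType)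
    (P : probability T R) (A : set T) (y : T -> R) (N s : R) :
  bounded_on A y N -> P.-integrable setT (EFin \o tilt A y s).
Proof.
move=> [mA my yN]; apply: measurable_bounded_integrable => //.
- by rewrite /= probability_setT ltry.
- exact: measurable_tilt.
exists (expR (`|s| * N)); split; first exact: num_real.
move=> r sr x _ /=; rewrite ger0_norm ?tilt_ge0//.
apply: le_trans (ltW sr); have [Ax|Ax] := pselect (A x); last first.
  by rewrite tilt_out// expR_ge0.
rewrite tilt_in// ler_expR; apply: le_trans (ler_norm _) _.
by rewrite normrN normrM ler_wpM2l// yN.
Qed.

Lemma tilt_mass_ge0 d (T : measurableType d) (R : realType)
    (P : probability T R) (A : set T) (y : T -> R) (s : R) :
  (0 <= tilt_mass P A y s)%R.
Proof. by apply: Rintegral_ge0 => x _; exact: tilt_ge0. Qed.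

Lemma EFin_tilt_mass d (T : measurableType d) (R : realType)
    (P : probability T R) (A : set T) (y : T -> R) (N s : R) :
  bounded_on A y N ->
  \int[P]_x (tilt A y s x)%:E = (tilt_mass P A y s)%:E.
Proof.
move=> bA; rewrite /tilt_mass /Rintegral fineK//.
exact: integrable_fin_num (integrable_tilt P s bA).
Qed.

(** Pointwise [exp (- v y) <= exp (v N)] on [A]. This crude control serves at the start of the grid,
    where no earlier decrease is available. *)
Lemma tilt_mass_shift d (T : measurableType d) (R : realType)
    (P : probability T R) (A : set T) (y : T -> R) (N s v : R) :
  bounded_on A y N -> (0 <= v)%R ->
  (tilt_mass P A y (s + v) <= expR (v * N) * tilt_mass P A y s)%R.
Proof.
move=> bA v0; have [mA my yN] := bA.
rewrite -RintegralZl//; last exact: integrable_tilt bA.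
apply: le_Rintegral => //.
- exact: integrable_tilt bA.
- exact: (integrableZl _ _ (integrable_tilt P s bA)).
move=> x _; have [Ax|Ax] := pselect (A x); last by rewrite !tilt_out// mulr0.
rewrite !tilt_in// -expRD ler_expR mulrDl opprD addrC lerD2r -mulrN.
by rewrite ler_wpM2l//; have := yN x Ax; rewrite ler_norml lerNl => /andP[].
Qed.

(** From [exp z <= 1 / (1 - z)] at [z = x] and [z = - x] the sum is at most [2 / (1 - x^2)]. *)
Lemma expR_sym_le (R : realType) (x : R) :
  (x ^+ 2 <= 2^-1 -> expR x + expR (- x) <= 2 * (1 + 2 * x ^+ 2))%R.
Proof.
move=> x2.
have x1 : (`|x| < 1)%R.
  rewrite -(@ltr_pXn2r _ 2)// ?nnegrE// expr1n real_normK ?num_real//.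
  by apply: le_lt_trans x2 _; rewrite invf_lt1// ltr1n.
have bound (z : R) : (`|z| < 1 -> expR z <= (1 - z)^-1)%R.
  move=> z1; have z_lt1 : (0 < 1 - z)%R.
    by rewrite subr_gt0; apply: le_lt_trans z1; exact: ler_norm.
  rewrite -[leLHS]invrK -expRN lef_pV2 ?posrE ?expR_gt0//.
  exact: expR_ge1Dx.
have bx := bound x x1; have bNx := bound (- x)%R.
rewrite normrN opprK in bNx; move: (bNx x1) => {}bNx.
apply: le_trans (lerD bx bNx) _.
have := x1; rewrite ltr_norml => /andP[xN1 xlt1].
have p1 : (0 < 1 - x)%R by rewrite subr_gt0.
have p2 : (0 < 1 + x)%R by rewrite -(opprK 1%R) addrC subr_gt0.
rewrite -{1}[(1 - x)^-1%R]mul1r -{1}[(1 + x)^-1%R]mul1r addf_div ?gt_eqF//.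
rewrite ler_pdivrMr ?mulr_gt0//.
(* With [u = x^2], [(1 + 2 u) (1 - u) = 1 + u (1 - 2 u)], and the last term is nonnegative because
   [u <= 1 / 2]. *)
have q0 : (0 <= x ^+ 2 * (1 - 2 * x ^+ 2))%R.
  by rewrite mulr_ge0 ?sqr_ge0//; lra.
by nra.
Qed.

(** The two shifts together multiply the integrand by [2 cosh (v y)] with [|v y| <= v N]. This
    bounds the second difference of the moment on a grid of mesh [v], relative to its middle
    value. *)
Lemma tilt_mass_sym d (T : measurableType d) (R : realType)
    (P : probability T R) (A : set T) (y : T -> R) (N s v : R) :
  bounded_on A y N -> (0 <= v)%R -> ((v * N) ^+ 2 <= 2^-1)%R ->
  (tilt_mass P A y (s + v) + tilt_mass P A y (s - v) <=
   2 * (1 + 2 * (v * N) ^+ 2) * tilt_mass P A y s)%R.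
Proof.
move=> bA v0 vN; have [mA my yN] := bA.
rewrite -RintegralD//; [|exact: integrable_tilt bA|exact: integrable_tilt bA].
rewrite -RintegralZl//; last exact: integrable_tilt bA.
apply: le_Rintegral => //.
- exact: (integrableD _ (integrable_tilt P (s + v)%R bA)
    (integrable_tilt P (s - v)%R bA)).
- exact: (integrableZl _ _ (integrable_tilt P s bA)).
move=> x _; have [Ax|Ax] := pselect (A x); last first.
  by rewrite !tilt_out// addr0 mulr0.
have vy : ((v * y x) ^+ 2 <= (v * N) ^+ 2)%R.
  rewrite -real_normK ?num_real// normrM (ger0_norm v0).
  have N0 : (0 <= N)%R := le_trans (normr_ge0 _) (yN x Ax).
  by rewrite ler_pXn2r// ?nnegrE ?mulr_ge0// ler_wpM2l// yN.
rewrite !tilt_in//.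
have -> : (- ((s + v) * y x) = - (v * y x) + - (s * y x))%R by ring.
have -> : (- ((s - v) * y x) = (v * y x) + - (s * y x))%R by ring.
rewrite !expRD -mulrDl ler_wpM2r ?expR_ge0// addrC.
apply: le_trans (expR_sym_le (le_trans vy vN)) _.
by rewrite ler_wpM2l// lerD2l ler_wpM2l.
Qed.

(** When [B] has positive mass and [delta > 0], this keeps the moment positive and drives it above 1
    for large [s]. *)
Lemma tilt_mass_ge d (T : measurableType d) (R : realType)
    (P : probability T R) (A B : set T) (y : T -> R) (N s delta : R) :
  bounded_on A y N -> measurable B -> B `<=` A ->
  (forall x, B x -> y x <= - delta)%R -> (0 <= s)%R ->
  (expR (s * delta) * fine (P B) <= tilt_mass P A y s)%R.
Proof.
move=> bA mB BA yB s0.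
rewrite -lee_fin -(EFin_tilt_mass P s bA) EFinM fineK ?fin_num_measure//.
rewrite -[B in P B]setIT -integral_indic//.
rewrite -ge0_integralZl_EFin ?expR_ge0//; last first.
  by apply/measurable_EFinP; exact: measurable_indic.
have [mA my _] := bA.
apply: ge0_le_integral => //.
- apply: emeasurable_funM => //; apply/measurable_EFinP.
  exact: measurable_indic.
- by apply/measurable_EFinP; exact: measurable_tilt.
move=> x _; rewrite -EFinM lee_fin indicE.
have [/set_mem Bx|_] := boolP (x \in B); last by rewrite mulr0 tilt_ge0.
rewrite mulr1 tilt_in; last exact: BA.
by rewrite ler_expR -mulrN ler_wpM2l// lerNr yB.
Qed.

Lemma tilt_mass0_le1 d (T : measurableType d) (R : realType)
    (P : probability T R) (A : set T) (y : T -> R) (N : R) :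
  bounded_on A y N -> (tilt_mass P A y 0 <= 1)%R.
Proof.
move=> bA; have [mA _ _] := bA; rewrite -lee_fin -(EFin_tilt_mass P 0%R bA).
under eq_integral do rewrite /tilt mul0r oppr0 expR0 mulr1.
by rewrite integral_indic// setIT probability_le1.
Qed.

(* On [A^t], write [S] for the sum of the [y (w i)]. Where [S <= 0] fails the
   tilt [s] is dominated by the tilt [s - v], where [- c t <= S] fails it is
   dominated by the tilt [s + v], and otherwise it is at most [e^(s c t)]. *)
Lemma tilt_mass_split d (T : measurableType d) (R : realType)
    (P : probability T R) (PP : probability (seq_space T) R)
    (A : set T) (y : T -> R) (N s v c : R) (G : set (seq_space T)) (t : nat) :
  is_iid_product P PP -> bounded_on A y N -> measurable G ->
  (forall w : seq_space T, (forall i, (i < t)%N -> A (w i)) ->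
    (\sum_(i < t) y (w i) <= 0)%R -> G w) ->
  (0 <= s)%R -> (0 <= v)%R ->
  (tilt_mass P A y s ^+ t <=
   expR (s * c) ^+ t * fine (PP G) + tilt_mass P A y (s - v) ^+ t +
   (expR (- (v * c)) * tilt_mass P A y (s + v)) ^+ t)%R.
Proof.
move=> iid bA mG AG s0 v0; have [mA my _] := bA.
have mtilt r : measurable_fun setT (fun x => (tilt A y r x)%:E).
  by apply/measurable_EFinP; exact: measurable_tilt.
have tilt0 r x : 0 <= (tilt A y r x)%:E by rewrite lee_fin tilt_ge0.
(* Powers of moments become integrals over sequence space, so that the inequality can be checked
   pointwise. *)
have powE r : (tilt_mass P A y r ^+ t)%:E =
    \int[PP]_w (\prod_(i < t) (tilt A y r (w i))%:E).
  rewrite (integral_prod_iid (f := fun=> fun x => (tilt A y r x)%:E) t iid)//.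
  by rewrite (EFin_tilt_mass P r bA) prode_const_ord EFin_expe.
have mprod r : measurable_fun setT
    (fun w : seq_space T => \prod_(i < t) (tilt A y r (w i))%:E).
  exact: (measurable_prod_coordinates t xpredT (fun=> mtilt r)).
have prod0 r (w : seq_space T) : 0 <= \prod_(i < t) (tilt A y r (w i))%:E.
  by rewrite prode_ge0.
rewrite -lee_fin !EFinD exprMn !EFinM !powE fineK ?fin_num_measure//.
rewrite -[G in PP G]setIT -integral_indic//.
rewrite -!ge0_integralZl_EFin ?exprn_ge0 ?expR_ge0//; last first.
  by apply/measurable_EFinP; exact: measurable_indic.
have mf1 : measurable_fun setT (fun w : seq_space T =>
    (expR (s * c) ^+ t)%:E * (\1_G w)%:E).
  apply: emeasurable_funM => //; apply/measurable_EFinP.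
  exact: measurable_indic.
have f10 (w : seq_space T) : 0 <= (expR (s * c) ^+ t)%:E * (\1_G w)%:E.
  by rewrite mule_ge0 ?lee_fin// exprn_ge0 ?expR_ge0.
have mf3 : measurable_fun setT (fun w : seq_space T =>
    (expR (- (v * c)) ^+ t)%:E * \prod_(i < t) (tilt A y (s + v) (w i))%:E).
  exact: emeasurable_funM.
have f30 (w : seq_space T) :
    0 <= (expR (- (v * c)) ^+ t)%:E * \prod_(i < t) (tilt A y (s + v) (w i))%:E.
  by rewrite mule_ge0 ?lee_fin// exprn_ge0 ?expR_ge0.
rewrite -ge0_integralD// -ge0_integralD//; last 2 first.
- by move=> w _; rewrite adde_ge0.
- exact: emeasurable_funD.
apply: ge0_le_integral => //.
  by apply: emeasurable_funD => //; exact: emeasurable_funD.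
move=> w _; have [wA|] := pselect (forall i, (i < t)%N -> A (w i)); last first.
  move=> /existsNP[i /not_implyP[it Awi]].
  rewrite [leLHS](bigD1 (Ordinal it))//= tilt_out// mul0e.
  by rewrite adde_ge0// adde_ge0.
pose S := (\sum_(i < t) y (w i))%R.
have prodE r : \prod_(i < t) (tilt A y r (w i))%:E = (expR (- (r * S)))%:E.
  rewrite prodEFin; congr EFin.
  rewrite mulr_sumr -sumrN expR_sum; apply: eq_bigr => i _.
  by rewrite tilt_in//; exact: wA.
rewrite !prodE -!EFinM -!EFinD lee_fin -!expRM_natr -expRD.
have e0 z : (0 <= expR z :> R)%R := expR_ge0 z.
have [S_gt0|S_le0] := ltP 0%R S.
  apply: (@le_trans _ _ (expR (- ((s - v) * S)))).
    by rewrite ler_expR lerN2 ler_wpM2r ?(ltW S_gt0)// lerBlDr lerDl.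
  by rewrite -addrA addrCA lerDl addr_ge0// mulr_ge0.
have [ctS|Sct] := leP (- (c * t%:R))%R S.
  rewrite indicE mem_set; last exact: AG.
  rewrite mulr1 -addrA -[leLHS]addr0 lerD ?addr_ge0// ler_expR.
  by rewrite -mulrA -mulrN ler_wpM2l// lerNl.
apply: (@le_trans _ _ (expR (- (v * c) * t%:R + - ((s + v) * S)))).
  rewrite ler_expR mulrDl opprD addrCA lerDl.
  rewrite mulNr -opprD -mulrA -mulrDr oppr_ge0.
  by rewrite mulr_ge0_le0// -lerBrDl sub0r ltW.
by rewrite lerDr addr_ge0// mulr_ge0.
Qed.

(** * Upper bound on the rate from a well-chosen tilt *)

Lemma limn_esup_le (R : realType) (u : (\bar R)^nat) (v : R^nat) (l : R) :
  v n @[n --> \oo] --> l -> (\forall n \near \oo, u n <= (v n)%:E) ->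
  limn_esup u <= l%:E.
Proof.
move=> vl uv; rewrite -leeN2 -limn_einfN -EFinN.
apply: (@limn_einf_ge _ _ (fun n => - v n)%R); first exact: cvgN.
by apply: filterS uv => n; rewrite EFinN leeN2.
Qed.

(** Both [m1 ^+ t] and [m2 ^+ t] are eventually at most a quarter of [m ^+ t], so the main term
    keeps half of it. Taking logarithms costs only [ln 2 / t]. *)
Lemma limn_esup_decay_rate_le (R : realType) (p : nat -> R) (m m1 m2 k : R) :
  (0 < m)%R -> (0 <= m1 < m)%R -> (0 <= m2 < m)%R ->
  (forall t, m ^+ t <= expR k ^+ t * p t + m1 ^+ t + m2 ^+ t)%R ->
  limn_esup (decay_rate (fun t => (p t)%:E)) <= (k - ln m)%:E.
Proof.
move=> m0 m1m m2m H.
have ratio n : (0 <= n < m)%R -> \forall t \near \oo, (n ^+ t <= m ^+ t / 4)%R.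
  move=> /andP[n0 nm].
  have nm0 : (0 <= n / m)%R by rewrite divr_ge0// ltW.
  have nm1 : (`|n / m| < 1)%R by rewrite ger0_norm// ltr_pdivrMr// mul1r.
  have /cvgr0Pnorm_le/(_ 4^-1%R) := cvg_expr nm1.
  have : (0 < 4^-1 :> R)%R by [].
  move=> /[swap]/[apply]; apply: filterS => t.
  rewrite normrX ger0_norm// exprMn exprVn ler_pdivrMr ?exprn_gt0//.
  by rewrite mulrC.
apply: (@limn_esup_le _ _ (fun t => k - ln m + ln 2 / t%:R)%R).
  rewrite -[X in _ --> X]addr0; apply: cvgD; first exact: cvg_cst.
  rewrite -[X in _ --> X](mulr0 (ln 2)); apply: cvgZl_tmp.
  exact: cvg_invn.
near=> t.
have t0 : (0 < t)%N by near: t; exists 1%N.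
have tR0 : (0 < t%:R :> R)%R by rewrite ltr0n.
have h1 : (m1 ^+ t <= m ^+ t / 4)%R by near: t; exact: ratio.
have h2 : (m2 ^+ t <= m ^+ t / 4)%R by near: t; exact: ratio.
have pt : (m ^+ t / 2 <= expR k ^+ t * p t)%R by move: (H t) h1 h2; lra.
have pt0 : (0 < p t)%R.
  have mt0 : (0 < m ^+ t / 2)%R by rewrite divr_gt0// exprn_gt0.
  by have := lt_le_trans mt0 pt; rewrite pmulr_rgt0// exprn_gt0// expR_gt0.
rewrite /decay_rate lne_EFin// -EFinM -EFinN lee_fin.
have : (ln (m ^+ t / 2) <= ln (expR k ^+ t * p t))%R.
  by rewrite ler_ln// posrE ?divr_gt0 ?mulr_gt0 ?exprn_gt0 ?expR_gt0.
rewrite ln_div ?posrE ?exprn_gt0// lnM ?posrE ?exprn_gt0 ?expR_gt0//.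
rewrite !lnXn ?expR_gt0// expRK -(mulr_natl k) -(mulr_natl (ln m)) => hln.
rewrite -(ler_pM2l tR0) mulrN mulVKf ?gt_eqF// mulrDr mulrCA divff ?gt_eqF//.
by rewrite mulr1; lra.
Unshelve. all: by end_near. Qed.

(** At its first increase the sequence has barely begun to grow: the step before was not an
    increase, and two successive second-difference bounds then limit the next ratio. If the first
    increase is at index 0, no earlier step exists. *)
Lemma first_increase (R : realType) (a : nat -> R) (kappa : R) (J : nat) :
  (0 <= kappa)%R -> (forall j, 0 < a j)%R ->
  (forall j, a j.+2 + a j <= 2 * (1 + kappa) * a j.+1)%R ->
  (a 0%N < a J)%R ->
  exists2 j, (j < J)%N & (a j < a j.+1)%R /\
    (j = 0%N \/ a j.+2 <= (1 + 4 * kappa) * a j.+1)%R.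
Proof.
move=> k0 a0 conv aJ.
have [j0 aj0] : exists j, (a j < a j.+1)%R.
  apply: contrapT => /forallNP H; move: aJ; apply/negP; rewrite -leNgt.
  by elim: J => // J ih; apply: le_trans ih; rewrite leNgt; exact/negP.
have exa : exists j, (a j < a j.+1)%R by exists j0.
case: (ex_minnP exa) => j aj jmin; exists j.
  rewrite ltnNge; apply/negP => Jj; move: aJ; apply/negP; rewrite -leNgt.
  elim: J Jj => // J ih Jj; apply: le_trans (ih (ltnW Jj)).
  by rewrite leNgt; apply/negP => /jmin; rewrite leqNgt Jj.
split=> //; case: j aj jmin => [|j] aj jmin; [by left|right].
have a1 : (a j.+1 <= a j)%R.
  by rewrite leNgt; apply/negP => /jmin; rewrite ltnn.
have c1 := conv j; have c2 := conv j.+1.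
have p0 := a0 j; have p1 := a0 j.+1; have p2 := a0 j.+2.
have b1 : (a j.+2 <= (1 + 2 * kappa) * a j.+1)%R by lra.
(* Either the left factor is nonpositive, or [b1] applies together with
   [(1 - 2 kappa) (1 + 2 kappa) <= 1]. *)
have b2 : ((1 - 2 * kappa) * a j.+2 <= a j.+1)%R.
  have [kk|kk] := leP (1 - 2 * kappa)%R 0%R.
    by apply: le_trans (ltW p1); rewrite mulr_le0_ge0// ltW.
  apply: le_trans (ler_wpM2l (ltW kk) b1) _.
  rewrite mulrA -[leRHS]mul1r ler_wpM2r ?(ltW p1)//.
  have : (0 <= kappa ^+ 2)%R := sqr_ge0 kappa.
  by rewrite expr2; lra.
by lra.
Qed.

(** The moment is at most 1 at 0 and exceeds 1 beyond [K], so it increases somewhere on a grid of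
    [[0, K + 1]]; [s] is the grid point just after the first increase. As [K] is tied to [B] and
    [delta], the bound on [s] survives when [A] and [N] grow. *)
Lemma exists_tilt d (T : measurableType d) (R : realType)
    (P : probability T R) (PP : probability (seq_space T) R)
    (A B : set T) (y : T -> R) (N delta K : R) (G : nat -> set (seq_space T)) :
  is_iid_product P PP -> bounded_on A y N -> (2 <= N)%R ->
  measurable B -> B `<=` A -> (forall x, B x -> y x <= - delta)%R ->
  (0 < delta)%R -> (0 <= K)%R -> (1 < expR (K * delta) * fine (P B))%R ->
  (forall t, measurable (G t)) ->
  (forall t w, (forall i, (i < t)%N -> A (w i)) ->
    (\sum_(i < t) y (w i) <= 0)%R -> G t w) ->
  exists s, [/\ (0 <= s <= K + 1)%R, (0 < tilt_mass P A y s)%R &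
    limn_esup (decay_rate (fun t => PP (G t))) <=
    (10 * (K + 1) / N - ln (tilt_mass P A y s))%:E].
Proof.
move=> iid bA N2 mB BA yB d0 K0 hK mG AG.
have N0 : (0 < N)%R by lra.
(* Then [v * N = N^-2], and [kappa] below equals [2 N^-4], the order of [v * c] when [c] is of order
   [1 / N]. *)
pose v : R := (N ^- 3)%R.
have v0 : (0 < v)%R by rewrite invr_gt0 exprn_gt0.
have NV : (N^-1 <= 2^-1)%R by rewrite lef_pV2 ?posrE.
have NV0 : (0 < N^-1)%R by rewrite invr_gt0.
have v1 : (v <= 1)%R by rewrite invf_le1 ?exprn_gt0// exprn_ege1//; lra.
have vN : (v * N = N^-1 ^+ 2)%R by rewrite /v; field; rewrite gt_eqF.
pose kappa : R := (2 * (v * N) ^+ 2)%R.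
have k0 : (0 < kappa)%R by rewrite mulr_gt0 ?exprn_gt0 ?mulr_gt0.
have vN2 : ((v * N) ^+ 2 <= 2^-1)%R.
  rewrite vN; have : (N^-1 ^+ 2 <= 2^-1 ^+ 2)%R.
    by rewrite ler_pXn2r// nnegrE ltW.
  move: (sqr_ge0 N^-1%R); set z := (N^-1 ^+ 2)%R => z0 z4.
  apply: le_trans (ler_wpM2r z0 z4) _.
  by lra.
pose a (j : nat) := tilt_mass P A y (j%:R * v).
have PB0 : (0 < fine (P B))%R.
  by rewrite -(pmulr_rgt0 _ (expR_gt0 (K * delta))); lra.
have Mpos s : (0 <= s)%R -> (0 < tilt_mass P A y s)%R.
  move=> s0; apply: lt_le_trans (tilt_mass_ge P bA mB BA yB s0).
  by rewrite mulr_gt0 ?expR_gt0.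
have jv0 (j : nat) : (0 <= j%:R * v)%R by rewrite mulr_ge0// ltW.
have a0 j : (0 < a j)%R by exact: Mpos.
have aconv j : (a j.+2 + a j <= 2 * (1 + kappa) * a j.+1)%R.
  have := tilt_mass_sym P (j.+1%:R * v)%R bA (ltW v0) vN2.
  have -> : (j.+1%:R * v + v = j.+2%:R * v)%R.
    by rewrite -[j.+2]addn1 natrD; ring.
  have -> : (j.+1%:R * v - v = j%:R * v)%R by rewrite -[j.+1]addn1 natrD; ring.
  by [].
(* The first grid point beyond [K]; it is at most [K + 1] because [v <= 1]. *)
pose J := (Num.truncn (K / v)).+1.
have KJ : (K <= J%:R * v)%R.
  by rewrite -ler_pdivrMr// ltW// truncnS_gt.
have JK : (J%:R * v <= K + 1)%R.
  have : ((Num.truncn (K / v))%:R * v <= K)%R.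
    by rewrite -ler_pdivlMr// truncn_le// divr_ge0// ltW.
  by rewrite /J -[(_.+1)]addn1 natrD mulrDl mul1r => h; lra.
have a0J : (a 0%N < a J)%R.
  apply: (@le_lt_trans _ _ 1%R).
    by rewrite /a mul0r (tilt_mass0_le1 P bA).
  apply: lt_le_trans (tilt_mass_ge P bA mB BA yB (jv0 J)).
  apply: lt_le_trans hK _; rewrite ler_wpM2r ?(ltW PB0)//.
  by rewrite ler_expR ler_wpM2r ?(ltW d0).
have [j jJ [aj hj]] := first_increase (ltW k0) a0 aconv a0J.
pose s := (j.+1%:R * v)%R.
have s_ge0 : (0 <= s)%R by exact: jv0.
have sK : (s <= K + 1)%R.
  by apply: le_trans JK; rewrite ler_wpM2r ?(ltW v0)// ler_nat.
exists s; split; [by rewrite s_ge0|exact: Mpos|].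
(* The slope [c] must be large enough for [exp (- v c)] to beat the growth from [s] to [s + v], yet
   keep the cost [s c] of order [1 / N]. *)
have [c [c0 vc sc]] : exists c, [/\ (0 <= c)%R,
    (expR (- (v * c)) * tilt_mass P A y (s + v) < tilt_mass P A y s)%R &
    (s * c <= 10 * (K + 1) / N)%R].
  have sv : (s + v = j.+2%:R * v)%R by rewrite /s -[j.+2]addn1 natrD; ring.
  case: hj => [j0|aj2].
    (* Here [s = v] is so small that a large [c] is affordable: [s c = 2 N^-2], while
       [exp (- 2 v N)] beats the crude growth [exp (v N)]. *)
    exists (2 * N)%R; split; first by rewrite mulr_ge0// ltW.
      apply: (@le_lt_trans _ _
        (expR (- (v * (2 * N))) * (expR (v * N) * tilt_mass P A y s)))%R.
        by rewrite ler_wpM2l ?expR_ge0// (tilt_mass_shift P s bA (ltW v0)).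
      rewrite mulrA -expRD gtr_pMl ?Mpos// -[ltRHS]expR0 ltr_expR.
      by rewrite mulrCA mulr_natl mulr2n opprD addrNK oppr_lt0 mulr_gt0.
    rewrite /s j0 mul1r mulrCA vN expr2 mulrA ler_wpM2r ?(ltW NV0)//.
    by move: K0 NV; clear; lra.
  (* This gives [v c = 5 kappa], and [1 + 4 kappa < 1 + 5 kappa <= exp (5 kappa)]. *)
  exists (10 / N)%R; split; first by rewrite divr_ge0// ltW.
    rewrite sv; apply: (@le_lt_trans _ _
      (expR (- (v * (10 / N))) * ((1 + 4 * kappa) * a j.+1)))%R.
      by rewrite ler_wpM2l ?expR_ge0.
    rewrite mulrA gtr_pMl ?a0//.
    have -> : (v * (10 / N) = 5 * kappa)%R.
      by rewrite /kappa vN /v; field; rewrite gt_eqF.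
    rewrite expRN -ltr_pdivlMl ?invr_gt0 ?expR_gt0// invrK mulr1.
    apply: lt_le_trans (expR_ge1Dx _).
    by rewrite ltrD2l ltr_pM2r// ltr_nat.
  rewrite mulrA ler_wpM2r ?(ltW NV0)// mulrC ler_wpM2l//.
have -> : decay_rate (fun t => PP (G t)) =
    decay_rate (fun t => (fine (PP (G t)))%:E).
  apply/funext => t; rewrite /decay_rate fineK//.
  exact: fin_num_measure.
apply: (@le_trans _ _ (s * c - ln (tilt_mass P A y s))%:E); last first.
  by rewrite lee_fin lerD2r.
apply: (@limn_esup_decay_rate_le _ _ _ (tilt_mass P A y (s - v))
  (expR (- (v * c)) * tilt_mass P A y (s + v))%R).
- exact: Mpos.
- rewrite tilt_mass_ge0/= (_ : s - v = j%:R * v)%R//.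
  by rewrite /s -[j.+1]addn1 natrD; ring.
- by rewrite vc andbT mulr_ge0 ?expR_ge0 ?tilt_mass_ge0.
move=> t; apply: tilt_mass_split => //.
- exact: bA.
- exact: AG.
- exact: ltW.
Qed.

(** * Truncation of [log E] to bounded bands *)

(** Meaningful only where [0 < E x < +oo]; elsewhere [fine] and [ln] supply default values. *)
Definition log_value (T : Type) (R : realType) (E : T -> \bar R) (x : T) : R :=
  ln (fine (E x)).

(** Bounding [E] itself, not [log_value E], excludes the values 0 and [+oo], whose default logarithm
    could satisfy the bound. *)
Definition log_band (T : Type) (R : realType) (E : T -> \bar R) (N : R) :
    set T :=
  [set x | (expR (- N))%:E <= E x <= (expR N)%:E].

Lemma log_valueK (T : Type) (R : realType) (E : T -> \bar R) (x : T) :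
  0 < E x -> E x < +oo -> E x = (expR (log_value E x))%:E.
Proof.
rewrite /log_value; case: (E x) => [r| |]//= r0 _.
by rewrite lnK// posrE -lte_fin.
Qed.

Lemma log_band_pos_fin (T : Type) (R : realType) (E : T -> \bar R) (N : R)
    (x : T) : log_band E N x -> 0 < E x /\ E x < +oo.
Proof.
move=> /andP[h1 h2]; split; last exact: le_lt_trans h2 (ltry _).
by apply: lt_le_trans h1; rewrite lte_fin expR_gt0.
Qed.

Lemma log_bandE (T : Type) (R : realType) (E : T -> \bar R) (N : R) (x : T) :
  0 < E x -> E x < +oo -> log_band E N x <-> (`|log_value E x| <= N)%R.
Proof.
move=> x0 xy; rewrite /log_band/= (log_valueK x0 xy) !lee_fin !ler_expR.
by rewrite ler_norml.
Qed.

Lemma measurable_band d (T : measurableType d) (R : realType) (E : T -> \bar R)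
    (a b : \bar R) :
  measurable_fun setT E -> measurable [set x | a <= E x <= b].
Proof.
move=> mE; rewrite (_ : [set x | _] = E @^-1` `[a, b]).
  rewrite -[X in measurable X]setTI; apply: mE => //; exact: emeasurable_itv.
by apply/seteqP; split => x /=; rewrite in_itv.
Qed.

Lemma bounded_on_log_band d (T : measurableType d) (R : realType)
    (E : T -> \bar R) (N : R) :
  measurable_fun setT E -> bounded_on (log_band E N) (log_value E) N.
Proof.
move=> mE; split; first exact: measurable_band.
  by do 2!apply: measurableT_comp => //.
move=> x Ax; have [x0 xy] := log_band_pos_fin Ax.
exact/(log_bandE N x0 xy).
Qed.

Lemma wealth_log_band (T : Type) (R : realType)
    (E : T -> \bar R) (N : R) (w : nat -> T) (t : nat) :
  (forall i, (i < t)%N -> log_band E N (w i)) ->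
  \prod_(i < t) E (w i) = (expR (\sum_(i < t) log_value E (w i)))%:E.
Proof.
move=> wA; rewrite expR_sum -prodEFin; apply: eq_bigr => i _.
by have [x0 xy] := log_band_pos_fin (wA i (ltn_ord i)); exact: log_valueK.
Qed.

(** These bands exhaust the event [0 < E < 1]. If all were null, so would be their countable union
    with the null event [E = 0]. *)
Lemma positive_sub_band d (T : measurableType d) (R : realType)
    (P : probability T R) (E : T -> \bar R) :
  measurable_fun setT E -> (forall x, 0 <= E x) ->
  P [set x | E x == 0] = 0 -> (0 < P [set x | E x < 1]) ->
  exists n : nat, 0 < P [set x | (expR (- n.+1%:R))%:E <= E x <=
    (expR (- n.+1%:R^-1))%:E].
Proof.
move=> mE E0 Ez E1; apply: contrapT => /forallNP H.
pose B n := [set x | (expR (- n.+1%:R))%:E <= E x <= (expR (- n.+1%:R^-1))%:E].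
have mB n : measurable (B n) by exact: measurable_band.
have PB n : P.-negligible (B n).
  apply/negligibleP => //; apply/eqP; rewrite eq_le measure_ge0 andbT leNgt.
  exact/negP/H.
have mE0 : measurable [set x | E x == 0] by exact: measurable_eq_cst.
have mE1 : measurable [set x | E x < 1].
  rewrite -[X in measurable X]setTI; exact: emeasurable_fun_infty_o.
move: E1; apply/negP; rewrite -leNgt le_eqVlt; apply/orP; left; apply/eqP.
apply/negligibleP => //.
have /negligibleP : P [set x | E x == 0] = 0 by [].
move=> /(_ mE0) Enull.
apply: negligibleS (negligibleU Enull (negligible_bigcup PB)).
move=> x /= Ex1; have [Ex0|Ex0] := eqVneq (E x) 0; [by left|right].
have x0 : 0 < E x by rewrite lt_neqAle eq_sym Ex0 E0.
have xy : E x < +oo by apply: lt_trans Ex1 (ltry _).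
have y_lt0 : (log_value E x < 0)%R.
  by move: Ex1; rewrite (log_valueK x0 xy) lte_fin expR_lt1.
set y := log_value E x in y_lt0 *.
(* Then [n.+1] exceeds both [- y] and [1 / (- y)]. *)
pose n := maxn (Num.truncn (- y)) (Num.truncn (- y)^-1).
exists n => //; rewrite /B /= (log_valueK x0 xy) !lee_fin !ler_expR -/y.
have Ny0 : (0 < - y)%R by rewrite oppr_gt0.
rewrite lerNl lerNr -[X in _ && (_ <= X)%R]invrK.
rewrite lef_pV2 ?posrE ?ltr0n ?invr_gt0//.
apply/andP; split; apply: le_trans (ltW (truncnS_gt _)) _.
  by rewrite ler_nat ltnS leq_maxl.
by rewrite ler_nat ltnS leq_maxr.
Qed.

(** * Removal of the truncation *)

Lemma measurable_fun_limn_einf d (T : measurableType d) (R : realType)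
    (f : (T -> \bar R)^nat) :
  (forall n, measurable_fun setT (f n)) ->
  measurable_fun setT (fun x => limn_einf (f ^~ x)).
Proof.
move=> mf; apply: measurableT_comp => //.
by apply: measurable_fun_limn_esup => n; exact: measurableT_comp.
Qed.

Lemma leq_increasing_seq (f : nat -> nat) (n : nat) :
  {mono f : m n / (m <= n)%N} -> (n <= f n)%N.
Proof.
move=> fmono; elim: n => // n ih; apply: leq_ltn_trans ih _.
by rewrite ltnNge fmono -ltnNge.
Qed.

Lemma limn_esup_gamma_le_Lambda d (T : measurableType d) (R : realType)
    (P : probability T R) (PP : probability (seq_space T) R)
    (E : T -> \bar R) (alpha : R) :
  is_iid_product P PP -> measurable_fun setT E -> (forall x, 0 <= E x) ->
  P [set x | E x == +oo] = 0 -> P [set x | E x == 0] = 0 ->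
  0 < P [set x | E x < 1] -> (0 < alpha)%R -> (alpha < 1)%R ->
  limn_esup (decay_rate (gamma PP E alpha)) <= Lambda P E.
Proof.
move=> iid mE E0 Ey Ez E1 a0 a1.
have [n0 PB] := positive_sub_band mE E0 Ez E1.
set B := [set x | _] in PB.
have mB : measurable B by exact: measurable_band.
have mG t : measurable [set w : seq_space T | wealth E t w <= (alpha^-1)%:E].
  exact: measurable_wealth_le.
have B_log x : B x ->
    [/\ 0 < E x, E x < +oo & (log_value E x <= - n0.+1%:R^-1)%R].
  move=> /andP[h1 h2].
  have x0 : 0 < E x by apply: lt_le_trans h1; rewrite lte_fin expR_gt0.
  have xy : E x < +oo by exact: le_lt_trans h2 (ltry _).
  by split => //; move: h2; rewrite (log_valueK x0 xy) lee_fin ler_expR.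
pose p := fine (P B).
have p0 : (0 < p)%R by rewrite fine_gt0// PB ltey_eq fin_num_measure.
pose delta : R := (n0.+1%:R^-1)%R.
have d0 : (0 < delta)%R by rewrite invr_gt0.
(* So [exp (K delta) p = exp (1 / p) p >= (1 + 1 / p) p = p + 1]. *)
pose K := (p^-1 / delta)%R.
have K0 : (0 <= K)%R by rewrite divr_ge0 ?(ltW d0)// invr_ge0 ltW.
have hK : (1 < expR (K * delta) * p)%R.
  rewrite divfK ?gt_eqF// -ltr_pdivrMr// mul1r.
  by apply: lt_le_trans (expR_ge1Dx _); rewrite ltrDr.
(* The offset ensures both [2 <= N n] and that every band contains [B]. *)
pose N (n : nat) : R := ((n + n0).+2%:R)%R.
pose M n s := tilt_mass P (log_band E (N n)) (log_value E) s.
have bA n := bounded_on_log_band (N n) mE.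
have /choice[s hs] : forall n, exists s,
  [/\ (0 <= s <= K + 1)%R, (0 < M n s)%R &
    limn_esup (decay_rate (gamma PP E alpha)) <=
    (10 * (K + 1) / N n - ln (M n s))%:E].
  move=> n; apply: (exists_tilt iid (bA n) _ mB _ _ d0 K0 hK mG).
  - by rewrite ler_nat.
  - move=> x /[dup] /B_log[x0 xy _] /andP[h1 h2]; apply/andP; split.
      apply: le_trans h1; rewrite lee_fin ler_expR lerN2 ler_nat.
      by rewrite ltnS ltnW// ltnS leq_addl.
    apply: le_trans h2 _; rewrite lee_fin ler_expR.
    by apply: (@le_trans _ _ 0%R); rewrite ?oppr_le0 ?invr_ge0.
  - by move=> x /B_log[].
  (* A nonpositive log-sum means wealth at most 1, hence below [1 / alpha]. *)
  move=> t w wA Sw; rewrite /= /wealth (wealth_log_band wA) lee_fin.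
  apply: (@le_trans _ _ 1%R); first by rewrite -expR0 ler_expR.
  by rewrite invf_ge1// ltW.
set L := limn_esup _ in hs *.
(* The limsup cannot be [+oo], by the real bound at [n = 0]; the value [-oo] is trivial. *)
case L_eq : L hs => [l| |] hs; last by rewrite leNye.
  2: by have [_ _] := hs 0%N; rewrite leye_eq.
have s_bounded : bounded_fun s.
  exists (K + 1)%R; split; first exact: num_real.
  move=> r Kr n _; have [/andP[s0 sK] _ _] := hs n.
  by rewrite /= ger0_norm// (le_trans sK)// ltW.
have [phi phi_mono /cvg_ex[/= s_lim s_cvg]] := bolzano_weierstrass s_bounded.
have phi_ge n : (n <= phi n)%N by exact: leq_increasing_seq.
have s_lim0 : (0 <= s_lim)%R.
  apply: (cvgr_to_ge s_cvg); apply: nearW => n.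
  by have [/andP[]] := hs (phi n).
pose f n x := (tilt (log_band E (N (phi n))) (log_value E) (s (phi n)) x)%:E.
have mf n : measurable_fun setT (f n).
  by apply/measurable_EFinP; have [? ? _] := bA (phi n); exact: measurable_tilt.
have f0 n x : 0 <= f n x by rewrite lee_fin tilt_ge0.
have int_f n : \int[P]_x f n x = (M (phi n) (s (phi n)))%:E.
  exact: EFin_tilt_mass (bA (phi n)).
(* The rate bound rearranges to [M <= exp (10 (K + 1) / N - l)], whose first term vanishes along the
   subsequence. *)
have int_le : limn_einf (fun n => \int[P]_x f n x) <= (expR (- l))%:E.
  apply: le_trans (limn_einf_sup _) _.
  apply: (@limn_esup_le _ _ (fun n => expR (10 * (K + 1) / N (phi n) - l))%R).
    apply: continuous_cvg; first exact: continuous_expR.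
    rewrite -[X in _ --> X]sub0r; apply: cvgB; last exact: cvg_cst.
    rewrite -[X in _ --> X](mulr0 (10 * (K + 1))%R); apply: cvgZl_tmp.
    apply: (@squeeze_cvgr _ _ _ _ (cst 0%R) (fun n => n%:R^-1 : R)%R).
    - exists 1%N => // n /= n1; rewrite invr_ge0 ler0n/=.
      rewrite lef_pV2 ?posrE ?ltr0n// ler_nat.
      by apply: leq_trans (phi_ge n) _; rewrite -addnS -addnS leq_addr.
    - exact: cvg_cst.
    - exact: cvg_invn.
  apply: nearW => n; have [_ M0 hl] := hs (phi n).
  rewrite int_f lee_fin -[leLHS]lnK ?posrE// ler_expR.
  by move: hl; rewrite lee_fin lerBrDr addrC -lerBrDr.
have f_cvg x : 0 < E x -> E x < +oo -> f n x @[n --> \oo] --> (E x `^ s_lim)^-1.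
  move=> x0 xy.
  have -> : (E x `^ s_lim)^-1 = (expR (- (s_lim * log_value E x)))%:E.
    rewrite {1}(log_valueK x0 xy) poweR_EFin inver gt_eqF ?powR_gt0 ?expR_gt0//.
    by rewrite /powR gt_eqF ?expR_gt0// expRK expRN.
  have : (expR (- (s (phi n) * log_value E x)))%:E @[n --> \oo] -->
      (expR (- (s_lim * log_value E x)))%:E.
    apply: cvg_EFin; first exact: nearW.
    apply: continuous_cvg; first exact: continuous_expR.
    by apply: cvgN; apply: cvgMr_tmp.
  apply: cvg_trans; apply: near_eq_cvg.
  (* As [N (phi n) >= n], the point lies in the band once [n] exceeds the absolute value of its
     logarithm. *)
  exists (Num.truncn `|log_value E x|%R).+1 => // n /= xn.
  rewrite /f tilt_in//; apply/(log_bandE _ x0 xy).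
  apply: le_trans (ltW (truncnS_gt _)) _; rewrite ler_nat.
  apply: leq_trans xn _; apply: leq_trans (phi_ge n) _.
  by rewrite -addnS -addnS leq_addr.
have mZ : measurable [set x | E x == 0] by exact: measurable_eq_cst.
have mY : measurable [set x | E x == +oo] by exact: measurable_eq_cst.
have einf0 x : 0 <= limn_einf (f ^~ x).
  by apply: (@limn_einf_ge _ _ (cst 0%R)); [exact: cvg_cst|exact: nearW].
have int_lim : \int[P]_x (E x `^ s_lim)^-1 <= (expR (- l))%:E.
  apply: le_trans int_le.
  (* Off the null events [E = 0] and [E = +oo] the integrand is the pointwise limit of the truncated
     ones, so Fatou's lemma applies. *)
  rewrite (integral_modify_null (mu := P)
    (N := [set x | E x == 0] `|` [set x | E x == +oo])
    (g := fun x => limn_einf (f ^~ x))) //.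
  - exact: fatou.
  - exact: measurableU.
  - by rewrite measureU0.
  - exact: measurable_neg_poweR.
  - exact: measurable_fun_limn_einf.
  - by move=> x; rewrite inve_ge0 poweR_ge0.
  move=> x /not_orP[/negP xz /negP xy].
  apply/esym/(cvg_limn_einf_sup _).1/f_cvg.
    by rewrite lt_neqAle eq_sym xz E0.
  by rewrite ltey.
apply: le_trans (ereal_sup_ubound _); last by exists s_lim.
rewrite /Lambda_at leeNr.
have -> : - l%:E = lne (expR (- l))%:E by rewrite lne_EFin ?expR_gt0// expRK.
rewrite lee_lne ?in_itv/= ?leey ?andbT ?lee_fin ?expR_ge0//.
by apply: integral_ge0 => x _; rewrite inve_ge0 poweR_ge0.
Qed.

(** * Consequences of the integrability and Cramér hypotheses *)

(** Identifies the integrand of [cramer_rate] at [theta = - s] with that of [Lambda_at], including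
    at 0 and [+oo]. *)
Lemma expeR_mul_lne (R : realType) (s : R) (x : \bar R) :
  (0 < s)%R -> 0 <= x -> expeR ((- s)%:E * lne x) = (x `^ s)^-1.
Proof.
move=> s0; case: x => [r| |]// => [|_].
  rewrite lee_fin le_eqVlt => /predU1P[<-|r0].
    rewrite le0_lneNy// poweR0r ?gt_eqF// inve0 lt0_muleNy// lte_fin.
    by rewrite oppr_lt0.
  rewrite lne_EFin// poweR_EFin inver gt_eqF ?powR_gt0//=.
  by rewrite /powR gt_eqF// mulNr expRN.
by rewrite poweRyr ?gt_eqF// invey/= lt0_muley ?lte_fin ?oppr_lt0.
Qed.

(** If [E >= 1] almost surely, then [E^(-s)] has mean at most 1 for [s > 0], so the rate at [x] is
    at least [- s x], which is unbounded as [x < 0]. *)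
Lemma cramer_rate_finite_neg d (T : measurableType d) (R : realType)
    (P : probability T R) (E : T -> \bar R) (x : R) :
  measurable_fun setT E -> (forall y, 0 <= E y) -> (x < 0)%R ->
  cramer_rate P (fun y => lne (E y)) x < +oo -> 0 < P [set y | E y < 1].
Proof.
move=> mE E0 x0; apply: contraTT; rewrite -!leNgt leye_eq => PE.
have mE1 : measurable [set y | E y < 1].
  rewrite -[X in measurable X]setTI; exact: emeasurable_fun_infty_o.
have E1 : P [set y | E y < 1] = 0 by apply/eqP; rewrite eq_le PE measure_ge0.
apply/eqP/eq_infty => r.
(* Chosen so that [- s x = |r| + 1], which is above [r]. *)
pose s := ((`|r| + 1) / - x)%R.
have Nx0 : (0 < - x)%R by rewrite oppr_gt0.
have s0 : (0 < s)%R by rewrite divr_gt0// ltr_wpDl.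
apply: le_trans (ereal_sup_ubound _); last by exists (- s)%R.
have int_le1 : \int[P]_y expeR ((- s)%:E * lne (E y)) <= 1.
  under eq_integral do rewrite expeR_mul_lne//.
  have int1 : \int[P]_y cst 1 y = 1.
    by rewrite integral_cst//= probability_setT mul1e.
  rewrite -[leRHS]int1.
  apply: ae_ge0_le_integral => //.
  - by move=> y _; rewrite inve_ge0 poweR_ge0.
  - exact: measurable_neg_poweR.
  exists [set y | E y < 1]; split => // y /= /not_implyP[_ Ey1].
  rewrite ltNge; apply: contra_notN Ey1 => Ey1.
  have h : 1 <= E y `^ s.
    rewrite -[leLHS](poweR1r s); apply: (gt0_ler_poweR (ltW s0)) => //;
    by rewrite in_itv/= leey andbT.
  by rewrite /= inve_ple ?inE ?poweR_ge0// inve1.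
have ln_le0 : lne (\int[P]_y expeR ((- s)%:E * lne (E y))) <= 0.
  by rewrite lne_le0.
apply: (@le_trans _ _ (- s * x)%:E); last first.
  by rewrite -[leLHS]sube0 leeB.
rewrite lee_fin mulNr -mulrN divfK ?gt_eqF//.
by apply: le_trans (ler_norm _) _; rewrite lerDl.
Qed.

Lemma measurable_fun_lne d (T : measurableType d) (R : realType)
    (f : T -> \bar R) :
  measurable_fun setT f -> (forall x, 0 <= f x) ->
  measurable_fun setT (fun x => lne (f x)).
Proof.
move=> mf f0; have -> : (fun x => lne (f x)) = fun x =>
    if f x == +oo then +oo else if f x == 0 then -oo else (ln (fine (f x)))%:E.
  apply/funext => x; have := f0 x; case: (f x) => [r| |]//=.
  by rewrite lee_fin eqe => r0; rewrite (eq_le r) r0 andbT.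
apply: measurable_fun_ifT; [exact: measurable_fun_eqe|exact: measurable_cst|].
apply: measurable_fun_ifT; [exact: measurable_fun_eqe|exact: measurable_cst|].
by apply/measurable_EFinP; do 2!apply: measurableT_comp => //.
Qed.

Lemma null_zero_of_log_integrable d (T : measurableType d) (R : realType)
    (P : probability T R) (E : T -> \bar R) :
  measurable_fun setT E -> (forall x, 0 <= E x) ->
  \int[P]_x `|lne (E x)| < +oo -> P [set x | E x == 0] = 0.
Proof.
move=> mE E0 intE.
have mN : measurable [set x | E x == 0] by exact: measurable_eq_cst.
apply/negligibleP => //.
have : P.-integrable setT (fun x => lne (E x)).
  by apply/integrableP; split => //; exact: measurable_fun_lne.
move=> /integrable_ae[//|A [mA A0 sA]]; exists A; split => // x /= /eqP Ex.
by apply: sA => /= /(_ I); rewrite Ex le0_lneNy.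
Qed.

Theorem proposition2p23 (R : realType) (d : measure_display)
    (T : measurableType d) (P0 P1 : probability T R)
    (PP1 : probability (seq_space T) R) (hPP1 : is_iid_product P1 PP1)
    (hdom : P1 `<< P0) (hKL : KL P1 P0 < +oo)
    (E : T -> \bar R) (mE : measurable_fun [set: T] E)
    (E_ge0 : forall x, 0 <= E x) (hE : \int[P0]_x E x <= 1)
    (alpha : R) (halpha0 : (0 < alpha)%R) (halpha1 : (alpha < 1)%R) :
  [/\ forall (s : R) (t : nat), (0 <= s)%R -> (0 < t)%N ->
        gamma_seq PP1 E alpha t <= gamma PP1 E alpha t
        /\ gamma PP1 E alpha t <=
           expeR ((s * ln (alpha^-1))%:E - t%:R%:E * Lambda_at P1 E s),
      Lambda P1 E <= limn_einf (decay_rate (gamma PP1 E alpha)),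
      \int[P1]_x `|lne (E x)| < +oo ->
        0 < \int[P1]_x lne (E x) ->
        [set x : R | cramer_rate P1 (fun y => lne (E y)) x < +oo]° 0%R ->
        decay_rate (gamma PP1 E alpha) t @[t --> \oo] --> Lambda P1 E
    & Lambda P1 E <= limn_einf (decay_rate (gamma_seq PP1 E alpha))].
Proof.
have Ey : P1 [set x | E x == +oo] = 0.
  by apply: (ae_lty_dominated hdom) => //; exact: le_lt_trans hE (ltry _).
have gamma_exp s t : (0 <= s)%R -> (0 < t)%N -> gamma PP1 E alpha t <=
    expeR ((s * ln (alpha^-1))%:E - t%:R%:E * Lambda_at P1 E s).
  by move=> s0 t0; exact: gamma_le_exp.
have gamma_seq_exp s t : (0 <= s)%R -> (0 < t)%N -> gamma_seq PP1 E alpha t <=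
    expeR ((s * ln (alpha^-1))%:E - t%:R%:E * Lambda_at P1 E s).
  move=> s0 t0; apply: le_trans (gamma_exp s t s0 t0).
  exact: gamma_seq_le_gamma.
have einf_ge : Lambda P1 E <= limn_einf (decay_rate (gamma PP1 E alpha)).
  by apply: Lambda_le_limn_einf gamma_exp => t; exact: measure_ge0.
split=> //.
- by move=> s t s0 t0; split; [exact: gamma_seq_le_gamma|exact: gamma_exp].
- move=> int_log _ /nbhs_ballP[e /= e0 he].
  have Ez := null_zero_of_log_integrable mE E_ge0 int_log.
  (* The interior hypothesis supplies the negative point [- e / 2], at which the rate is finite. *)
  have E1 : 0 < P1 [set x | E x < 1].
    apply: (@cramer_rate_finite_neg _ _ _ _ _ (- (e / 2))%R) => //.
      by rewrite oppr_lt0 divr_gt0.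
    apply: he; rewrite /ball/= sub0r opprK ger0_norm ?divr_ge0 ?ltW//.
    by rewrite ltr_pdivrMr// ltr_pMr// ltr1n.
  have esup_le :=
    limn_esup_gamma_le_Lambda hPP1 mE E_ge0 Ey Ez E1 halpha0 halpha1.
  set u := decay_rate _ in einf_ge esup_le *.
  have sup_inf := limn_einf_sup u.
  (* The sequence lies between its tail infima and tail suprema, and both tend to [Lambda P1 E]. *)
  apply: (@squeeze_cvge _ _ _ _ (einfs u) _ (esups u)).
  - apply: nearW => n; apply/andP; split.
      by apply: ereal_inf_lbound; exists n => /=.
    by apply: ereal_sup_ubound; exists n => /=.
  - have -> : Lambda P1 E = limn_einf u.
      by apply/eqP; rewrite eq_le einf_ge (le_trans sup_inf).
    by rewrite limn_einf_lim; exact: is_cvg_einfs.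
  - have -> : Lambda P1 E = limn_esup u.
      by apply/eqP; rewrite eq_le esup_le andbT (le_trans einf_ge).
    by rewrite limn_esup_lim; exact: is_cvg_esups.
by apply: Lambda_le_limn_einf gamma_seq_exp => t; exact: measure_ge0.
Qed.
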